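(* Let $m, n$ be positive integers, let $a_1,\dots,a_n,b_1,\dots,b_m$ be positive integers, and let $p_1,\dots,p_n,q_1,\dots,q_m \in \mathbb{Z}$. Consider the Diophantine equation \[ \sum_{i=1}^n p_{i}\, x_{i}^{a_i}=\sum_{j=1}^m q_{j}\, y_{j}^{b_j} \] in the unknowns $x_1,\dots,x_n,y_1,\dots,y_m$. Suppose that either there is an index $i$ with $p_i=1$ and $\gcd\!\left(a_{i},\, a_{1} \cdots a_{i-1} \cdot a_{i+1} \cdots a_{n} \cdot b_{1} \cdots b_{m}\right)=1$, or there is an index $j$ with $q_j=1$ and $\gcd\!\left(b_{j},\, a_{1} \cdots a_{n} \cdot b_{1} \cdots b_{j-1} \cdot b_{j+1} \cdots b_{m}\right)=1$. Then this equation has a parametric solution and infinitely many solutions in nonzero integers.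
   Context: A parametric solution is a family of solutions whose entries are given by explicit integer-valued expressions in arbitrary integer parameters.
   Formalization: The claim of infinitely many solutions in nonzero integers is made only when at least two of the coefficients p_i, q_j are nonzero; otherwise it fails, e.g. x_1 = 0·y_1 with n = m = 1 forces x_1 = 0. *)

(* Defs.v *)
From HB Require Import structures.
From mathcomp Require Import all_boot all_order all_algebra.
From mathcomp Require Import mpoly.
From mathcomp Require Import classical_sets cardinality.

Set Implicit Arguments.
Unset Strict Implicit.
Unset Printing Implicit Defensive.

Import GRing.Theory.

Local Open Scope ring_scope.
Local Open Scope classical_set_scope.

Definition unknowns (n m : nat) : Type :=
  ({ffun 'I_n -> int} * {ffun 'I_m -> int})%type.

Definition solutions (n m : nat) (a : 'I_n -> nat) (b : 'I_m -> nat)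
    (p : 'I_n -> int) (q : 'I_m -> int) : set (unknowns n m) :=
  [set z : unknowns n m |
    \sum_(i < n) p i * z.1 i ^+ a i = \sum_(j < m) q j * z.2 j ^+ b j].

Definition nonzero_entries (n m : nat) : set (unknowns n m) :=
  [set z : unknowns n m | (forall i, z.1 i != 0) /\ (forall j, z.2 j != 0)].

Definition param_family (n m k : nat) (X : 'I_n -> {mpoly int[k]})
    (Y : 'I_m -> {mpoly int[k]}) (t : 'I_k -> int) : unknowns n m :=
  ([ffun i => (X i).@[t]], [ffun j => (Y j).@[t]]).

(* The infiniteness clause rules out constant families, such as the zero
   solution; in particular it forces k > 0. *)
Definition parametric_solution (n m : nat) (a : 'I_n -> nat) (b : 'I_m -> nat)
    (p : 'I_n -> int) (q : 'I_m -> int) (k : nat)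
    (X : 'I_n -> {mpoly int[k]}) (Y : 'I_m -> {mpoly int[k]}) : Prop :=
  (forall t : 'I_k -> int, solutions a b p q (param_family X Y t)) /\
  infinite_set (range (param_family X Y)).

(* If c is the only nonzero coefficient, the equation reads c * z ^+ d = 0 and
   forces z = 0: it then has no solution in nonzero integers. *)
Definition two_nonzero_coefs (n m : nat) (p : 'I_n -> int) (q : 'I_m -> int) :
    Prop :=
  (1 < #|[pred i | p i != 0%R]| + #|[pred j | q j != 0%R]|)%N.

(* Main.v *)
(** Move everything to one side: [\sum_k c k * z k ^+ d k = 0], with
    [c k0 = 1] or [-1] and [d k0] coprime to [L], the product of the other
    exponents.  Bezout gives [d k0 * u = L * v + 1].  For arbitrary [t],
    put [S = - c k0 * \sum_(k != k0) c k * t k ^+ d k].  Scaling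
    [z k = t k * S ^+ (L * v / d k)] turns that sum into
    [S ^+ (L * v + 1) = (S ^+ u) ^+ d k0], so [z k0 = S ^+ u] solves the
    equation.  If some [c k1 != 0] with [k1 != k0], letting [t k1] grow
    makes [|S|], hence [|z k0|], arbitrarily large.  If there is no such [k1],
    then [S = 0], and the family [z k0 = 0], [z k = t k] is used instead. *)
Require Import Defs.
From HB Require Import structures.
From mathcomp Require Import all_boot all_order all_algebra.
From mathcomp Require Import mpoly.
From mathcomp Require Import boolp classical_sets cardinality.
From mathcomp Require Import zify.

Import Order.TTheory GRing.Theory Num.Theory.

Local Open Scope ring_scope.
Local Open Scope classical_set_scope.

Lemma infinite_set_unbounded (T : choiceType) (A : set T) (g : T -> nat) :
  (forall N, exists2 x, A x & (N <= g x)%N) -> infinite_set A.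
Proof.
move=> unb finA.
have /finite_seqP[s gA] : finite_set (g @` A) by exact: finite_image.
have [x Ax] := unb (\max_(i <- s) i).+1.
rewrite ltnNge => /negP; apply.
have : (g @` A) (g x) by exists x.
by rewrite gA /= => gs; apply: (@leq_bigmax_seq _ s xpredT id).
Qed.

Lemma absz_leX (x : int) (e : nat) : (0 < e)%N -> (`|x| <= `|(x ^+ e)%R|)%N.
Proof.
move=> e0; rewrite abszX; case: `|x|%N => [//|y].
by rewrite -{1}(expn1 y.+1) leq_pexp2l.
Qed.

Section ZeroSum.
Variables (K : finType) (c : K -> int) (d : K -> nat) (k0 : K).
Hypothesis d_gt0 : forall k, (0 < d k)%N.
Hypothesis c_k0 : c k0 * c k0 = 1.
Let L := (\prod_(k | k != k0) d k)%N.
Hypothesis coL : coprime (d k0) L.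

Lemma bezout_exponents :
  exists u v, (0 < u)%N /\ (d k0 * u = (L * v).+1)%N.
Proof.
have [v _] := Bezoutl L (d_gt0 k0); rewrite (eqP coL) => /dvdnP[u uE].
(* The value [u = 0] would give [0 = L * v + 1]. *)
by exists u, v; case: u uE => [|u] uE; lia.
Qed.

Section Scaled.
Variables (R : comNzRingType) (u v : nat) (t : K -> R).

(** The ring [R] stays general because the construction is used twice: over [{mpoly int[r]}] to give
    the family, and over [int] to estimate its values. *)
Definition scale_base : R :=
  - (c k0)%:~R * \sum_(k | k != k0) (c k)%:~R * t k ^+ d k.

Definition scaled (k : K) : R :=
  if k == k0 then scale_base ^+ u else t k * scale_base ^+ ((L * v) %/ d k).

Lemma scaled_zero_sum : (d k0 * u = (L * v).+1)%N ->
  \sum_k (c k)%:~R * scaled k ^+ d k = 0.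
Proof.
move=> uvE; rewrite (bigD1 k0) //= /scaled eqxx -exprM mulnC uvE.
rewrite (eq_bigr (fun k => scale_base ^+ (L * v) * ((c k)%:~R * t k ^+ d k))).
  (* Factoring out [scale_base ^+ (L * v)] leaves [c k0 * scale_base] plus the unscaled sum, which
     cancel because [c k0] squares to 1. *)
  rewrite -mulr_sumr exprSr mulrCA -mulrDr.
  rewrite {2}/scale_base mulrA mulrN -intrM c_k0 mulN1r.
  by rewrite addNr mulr0.
(* For [k != k0], [d k] is a factor of [L], so the truncated quotient in [scaled] is exact. *)
move=> k kk0; rewrite (negPf kk0) exprMn -exprM divnK; last first.
  by rewrite dvdn_mulr // /L (bigD1 k) //= dvdn_mulr.
by rewrite mulrA mulrC.
Qed.
End Scaled.

Lemma scaled_unbounded (u v : nat) (k1 : K) (N : nat) :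
  (0 < u)%N -> k1 != k0 -> c k1 != 0 ->
  exists t : K -> int, (forall k, scaled int u v t k != 0) /\
    (N <= `|scaled int u v t k0|)%N.
Proof.
move=> u0 k10 ck1.
(* All parameters but [t k1 = T] are set to 1, so the other terms add up to the constant [C]. The
   choice of [T] makes the [k1] term exceed [N] plus the absolute value of [C]. *)
pose C : int := \sum_(k | (k != k0) && (k != k1)) c k.
pose T : int := (N + `|C|)%N.+1%:Z.
pose t k : int := if k == k1 then T else 1.
have SE : scale_base int t = - c k0 * (c k1 * T ^+ d k1 + C).
  rewrite /scale_base (bigD1 k1) //= !intz /t eqxx; congr (_ * (_ + _)).
  by apply: eq_bigr => k /andP[_ /negPf->]; rewrite expr1n mulr1 intz.
have absk0 : `|c k0|%N = 1%N.
  by move: (congr1 absz c_k0) => /eqP; rewrite abszM muln_eq1 => /andP[/eqP].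
have S_gt : (N < `|scale_base int t|)%N.
  rewrite SE abszM abszN absk0 mul1n.
  have := absz_leX T _ (d_gt0 k1).
  have : (`|(T ^+ d k1)%R| <= `|(c k1 * T ^+ d k1)%R|)%N.
    by rewrite abszM leq_pmull // absz_gt0.
  move: (c k1 * _) => y; rewrite [`|T|%N]/=; lia.
have S0 : scale_base int t != 0 by rewrite -absz_gt0; apply: leq_ltn_trans S_gt.
exists t; split=> [k|]; last first.
  by rewrite /scaled eqxx (leq_trans (ltnW S_gt)) // absz_leX.
rewrite /scaled; case: (k == k0); first by rewrite expf_neq0.
by rewrite mulf_neq0 ?expf_neq0 // /t; case: (k == k1).
Qed.

Let r := #|K|.
Let var (k : K) : {mpoly int[r]} := 'X_(enum_rank k).

(** Evaluation is a ring morphism, hence commutes with the construction; integer estimates thus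
    carry over to the polynomials. *)
Lemma meval_scaled (u v : nat) (t : 'I_r -> int) (k : K) :
  (scaled {mpoly int[r]} u v var k).@[t]
  = scaled int u v (t \o enum_rank) k.
Proof.
have SE : (scale_base {mpoly int[r]} var).@[t] = scale_base int (t \o enum_rank).
  rewrite /scale_base rmorphM rmorphN rmorph_int rmorph_sum; congr (_ * _).
  by apply: eq_bigr => i _; rewrite rmorphM rmorph_int rmorphXn /= mevalXU.
by rewrite /scaled; case: eqP => _; rewrite ?rmorphM rmorphXn /= SE ?mevalXU.
Qed.

(** The second clause, needed for infiniteness, leaves its coordinate open: it is [k0] in the scaled
    family and [k2] in the degenerate one. *)
Lemma zero_sum_family : (exists k, k != k0) ->
  exists P : K -> {mpoly int[r]},
  [/\ forall t, \sum_k c k * (P k).@[t] ^+ d k = 0,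
      exists k, forall N, exists t, (N <= `|(P k).@[t]|)%N
    & (exists2 k, k != k0 & c k != 0) ->
      forall N, exists t, (forall k, (P k).@[t] != 0) /\
        (N <= `|(P k0).@[t]|)%N].
Proof.
move=> [k2 k20].
have [[k1 k10 ck1]|noc] := pselect (exists2 k, k != k0 & c k != 0); last first.
  exists (fun k => if k == k0 then 0 else var k); split.
  - move=> t; rewrite big1 // => k _; have [->|kk0] := eqVneq k k0.
      (* Positivity of the exponent matters here, since [0 ^+ 0 = 1]. *)
      by rewrite meval0 expr0n gtn_eqF // mulr0.
    by have [->|ck] := eqVneq (c k) 0; [rewrite mul0r | case: noc; exists k].
  - exists k2 => N; exists (fun=> N%:Z).
    by rewrite (negPf k20) mevalXU.
  - by [].
have [u [v [u0 uvE]]] := bezout_exponents.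
have unb N : exists t, (forall k, (scaled _ u v var k).@[t] != 0) /\
    (N <= `|(scaled _ u v var k0).@[t]|)%N.
  have [t [t0 tN]] := scaled_unbounded u v k1 N u0 k10 ck1.
  have tE : (t \o enum_val) \o enum_rank = t.
    by apply/funext => k /=; rewrite enum_rankK.
  exists (t \o enum_val); rewrite meval_scaled tE; split=> // k.
  by rewrite meval_scaled tE.
exists (scaled _ u v var); split=> //.
- move=> t; rewrite -[RHS](scaled_zero_sum int u v (t \o enum_rank) uvE).
  by apply: eq_bigr => k _; rewrite meval_scaled intz.
- by exists k0 => N; have [t [_ tN]] := unb N; exists t.
Qed.
End ZeroSum.

Section TwoSided.
Variables (n m : nat) (a : 'I_n -> nat) (b : 'I_m -> nat).
Variables (p : 'I_n -> int) (q : 'I_m -> int).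
Let K : finType := ('I_n + 'I_m)%type.

(** Indexing by the disjoint union turns both alternatives of the hypothesis into a choice of
    [k0]. *)
Definition side_coef (k : K) : int :=
  match k with inl i => p i | inr j => - q j end.

Definition side_exp (k : K) : nat :=
  match k with inl i => a i | inr j => b j end.

Definition entry (z : unknowns n m) (k : K) : int :=
  match k with inl i => z.1 i | inr j => z.2 j end.

Lemma solutionsE (z : unknowns n m) :
  solutions a b p q z <->
  \sum_k side_coef k * entry z k ^+ side_exp k = 0.
Proof.
rewrite big_sumType /=; under [X in _ <-> _ + X = _]eq_bigr do rewrite mulNr.
rewrite sumrN; split=> [->|/eqP]; first by rewrite subrr.
by rewrite subr_eq0 => /eqP.
Qed.

(** Of two distinct indices with nonzero coefficient, at most one is [k0]. *)
Lemma two_nonzero_coefs_other (k0 : K) :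
  two_nonzero_coefs p q -> exists2 k, k != k0 & side_coef k != 0.
Proof.
rewrite /two_nonzero_coefs.
have -> : (#|[pred i | p i != 0]| + #|[pred j | q j != 0]|)%N
    = #|[pred k | side_coef k != 0]|.
  rewrite -!sum1_card big_sumType /=; congr (_ + _)%N.
  by apply: eq_bigl => j; rewrite !inE /= oppr_eq0.
move=> /card_gt1P[x [y [xc yc xy]]].
by have [xk0|xk0] := eqVneq x k0; [exists y; rewrite // -xk0 eq_sym | exists x].
Qed.

Lemma parametric_solution_of_coprime (k0 : K) :
  (1 < #|K|)%N -> (forall k, (0 < side_exp k)%N) ->
  side_coef k0 * side_coef k0 = 1 ->
  coprime (side_exp k0) (\prod_(k | k != k0) side_exp k) ->
  exists (r : nat) (X : 'I_n -> {mpoly int[r]}) (Y : 'I_m -> {mpoly int[r]}),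
    parametric_solution a b p q X Y /\
    (two_nonzero_coefs p q ->
      infinite_set (range (param_family X Y) `&` @nonzero_entries n m)).
Proof.
move=> K_gt1 e_gt0 ck0 co.
have ex : exists k, k != k0.
  have /card_gt1P[x [y [_ _ xy]]] := K_gt1.
  by have [xk0|] := eqVneq x k0; [exists y; rewrite -xk0 eq_sym | exists x].
have [P [Psol [k Punb] Pnz]] := zero_sum_family K _ _ k0 e_gt0 ck0 co ex.
exists _, (P \o inl), (P \o inr).
have fE t k' : entry (param_family (P \o inl) (P \o inr) t) k' = (P k').@[t].
  by case: k' => i; rewrite /= ffunE.
split; first split.
- move=> t; apply/solutionsE; rewrite -[RHS](Psol t).
  by apply: eq_bigr => k' _; rewrite fE.
- apply: (infinite_set_unbounded _ _ (fun z => `|entry z k|%N)) => N.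
  have [t tN] := Punb N.
  by exists (param_family (P \o inl) (P \o inr) t); [exists t | rewrite fE].
- move=> /(two_nonzero_coefs_other k0)/Pnz nz.
  apply: (infinite_set_unbounded _ _ (fun z => `|entry z k0|%N)) => N.
  have [t [t0 tN]] := nz N.
  exists (param_family (P \o inl) (P \o inr) t); last by rewrite fE.
  by split; [exists t | split=> i; rewrite /= ffunE; apply: t0].
Qed.
End TwoSided.

Theorem mainTheorem2 (n m : nat) (n_gt0 : (0 < n)%N) (m_gt0 : (0 < m)%N)
    (a : 'I_n -> nat) (b : 'I_m -> nat)
    (a_gt0 : forall i, (0 < a i)%N) (b_gt0 : forall j, (0 < b j)%N)
    (p : 'I_n -> int) (q : 'I_m -> int)
    (H : (exists i : 'I_n, p i = 1 /\
            gcdn (a i)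
              ((\prod_(i' < n | i' != i) a i') * (\prod_(j < m) b j))%N = 1%N)
      \/ (exists j : 'I_m, q j = 1 /\
            gcdn (b j)
              ((\prod_(i < n) a i) * (\prod_(j' < m | j' != j) b j'))%N
            = 1%N)) :
  (exists (k : nat) (X : 'I_n -> {mpoly int[k]}) (Y : 'I_m -> {mpoly int[k]}),
     parametric_solution a b p q X Y /\
     (two_nonzero_coefs p q ->
        infinite_set (range (param_family X Y) `&` @nonzero_entries n m)))
  /\
  (two_nonzero_coefs p q ->
     infinite_set (solutions a b p q `&` @nonzero_entries n m)).
Proof.
suff par : exists (k : nat) (X : 'I_n -> {mpoly int[k]})
    (Y : 'I_m -> {mpoly int[k]}), parametric_solution a b p q X Y /\
    (two_nonzero_coefs p q ->
       (* The family alone suffices: its infinitely many nonzero members are solutions. *)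
       infinite_set (range (param_family X Y) `&` @nonzero_entries n m)).
  split=> // pq2; have [k [X [Y [[sol _] /(_ pq2)]]]] := par.
  by apply: sub_infinite_set => z [[t _ <-] nz]; split=> //; apply: sol.
have K_gt1 : (1 < #|{: 'I_n + 'I_m}|)%N by rewrite card_sum !card_ord; lia.
have e_gt0 k : (0 < side_exp n m a b k)%N by case: k.
case: H => [[i [pi co]]|[j [qj co]]].
- apply: (parametric_solution_of_coprime n m a b p q (inl i)) => //.
    by rewrite /= pi mulr1.
  by rewrite /coprime big_sumType /= co.
(* On the right-hand side the moved coefficient is [-1], whose square is still 1. *)
- apply: (parametric_solution_of_coprime n m a b p q (inr j)) => //.
    by rewrite /= qj mulrNN mulr1.
  by rewrite /coprime big_sumType /= co.
Qed.
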